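(* Let $\Gamma$ be a countable group and let $\Gamma \curvearrowright (X,\mathcal{B},\mu)$ be an ergodic probability-measure-preserving action on a standard probability space, such that $\mu$ is not supported on a finite set. Then $\Gamma \curvearrowright (X,\mathcal{B},\mu)$ is measure-theoretically isomorphic to $\Gamma \curvearrowright (\mathrm{Ord}(\Gamma),\nu)$ for some $\Gamma$-invariant Borel probability measure $\nu$ on $\mathrm{Ord}(\Gamma)$ if and only if there exists a $\Gamma$-equivariant measurable function $\pi : X \to \mathrm{pOrd}(\Gamma)$ such that for $\mu$-almost every $x \in X$, the restriction of the partial order $\pi(x)$ to the stabilizer subgroup $\mathrm{stab}(x) = \{\gamma \in \Gamma : \gamma x = x\}$ is a left-invariant total order on the group $\mathrm{stab}(x)$.
   Context: For a countable group $\Gamma$, $\mathrm{pOrd}(\Gamma)$ is the set of (strict) partial orders on the set $\Gamma$: binary relations $\prec$ such that $x \not\prec x$ for all $x$; $x \prec y$ implies $y \not\prec x$; and $x\prec y$, $y \prec z$ imply $x \prec z$. $\mathrm{Ord}(\Gamma) \subset \mathrm{pOrd}(\Gamma)$ is the set of total orders, i.e. those for which additionally for all $x \neq y$ either $x \prec y$ or $y \prec x$. Identifying a relation with its indicator function, both are closed subsets of $\{0,1\}^{\Gamma\times\Gamma}$ with the product topology, hence compact metrizable. $\Gamma$ acts on both by homeomorphisms via left multiplication: $x\,(\gamma\cdot\prec)\,y$ if and only if $\gamma^{-1}x \prec \gamma^{-1}y$. Equivariance of $\pi$ is with respect to this action. An order $\prec$ on a group $\Delta$ is left-invariant if $x \prec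 y \iff \gamma x \prec \gamma y$ for all $x,y,\gamma\in\Delta$. Measure-theoretic isomorphism means an equivariant measure-preserving bimeasurable bijection between invariant subsets of full measure. *)

(* Defs.v *)
From HB Require Import structures.
From mathcomp Require Import all_boot all_order all_algebra.
From mathcomp Require Import all_classical all_reals all_analysis.
From mathcomp Require wochoice.

Set Implicit Arguments.
Unset Strict Implicit.
Unset Printing Implicit Defensive.

Local Open Scope classical_set_scope.

Definition strict_order (T : Type) (r : rel T) : Prop :=
  [/\ irreflexive r, (forall x y, r x y -> ~~ r y x) & transitive r].

Definition strict_total_order (T : Type) (r : rel T) : Prop :=
  strict_order r /\ (forall x y, x <> y -> r x y \/ r y x).

Definition rel_restrict (T : Type) (S : set T) (r : rel T) : rel S :=
  fun u v => r (set_val u) (set_val v).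

(* For a subgroup S of G, this is left-invariance on the group S of the
   restriction of r to S. *)
Definition left_invariant_on (G : groupType) (S : set G) (r : rel G) : Prop :=
  forall g x y, S g -> S x -> S y -> r x y <-> r (g * x)%g (g * y)%g.

Definition borel (T : ptopologicalType) := g_sigma_algebraType (@open T).

Section Orders.
Context (G : groupType).

(* {0,1}^(G x G) with the product topology *)
Definition relspace := {ptws (G * G) -> bool}.

Definition rel_of (r : relspace) : rel G := fun x y => r (x, y).

Definition pOrd_set : set relspace := [set r | strict_order (rel_of r)].
Definition Ord_set : set relspace := [set r | strict_total_order (rel_of r)].

Definition pOrd : Type := set_type pOrd_set.
Definition Ord : Type := set_type Ord_set.
HB.instance Definition _ := Topological.on pOrd.
HB.instance Definition _ := Topological.on Ord.

Definition pOrd_rel (o : pOrd) : rel G := rel_of (set_val o).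

Lemma empty_pOrd : (fun=> false) \in pOrd_set.
Proof. by rewrite inE. Qed.

Lemma Ord_nonempty : exists r, r \in Ord_set.
Proof.
have [R wo] := wochoice.well_ordering_principle G.
have chR : wochoice.wo_chain R predT by move=> A _; exact: wo.
have Rtot x y : R x y || R y x by exact: wochoice.wo_chainW chR x y isT isT.
have Ranti x y : R x y -> R y x -> x = y.
  move=> xy yx.
  have anti := wochoice.wo_chain_antisymmetric chR.
  by apply: (anti x y isT isT); rewrite xy yx.
have Rtr : transitive R.
  move=> y x z xy yz.
  have [|m [[mA mle] _]] := wo (mem [:: x; y; z]).
    by exists x; exact: mem_head.
  have [mx my mz] : [/\ R m x, R m y & R m z].
    by split; apply: mle; rewrite !inE eqxx ?orbT.
  move: mA; rewrite !inE => /or3P[] /eqP E; rewrite E in mx my mz => //.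
  - by rewrite (Ranti _ _ xy mx).
  - by rewrite -(Ranti _ _ yz my).
exists (fun p => (p.1 != p.2) && R p.1 p.2); apply/mem_set.
split; first split.
- by move=> x; rewrite /rel_of /= eqxx.
- move=> x y; rewrite /rel_of /= => /andP[/eqP nxy xy].
  by apply/negP => /andP[_ yx]; apply/nxy/Ranti.
- move=> y x z; rewrite /rel_of /= => /andP[/eqP nxy xy] /andP[/eqP nyz yz].
  rewrite (Rtr _ _ _ xy yz) andbT; apply/eqP => xz; apply/nxy/Ranti => //.
  by rewrite xz.
- move=> x y /eqP nxy; rewrite /rel_of /= (eq_sym y) nxy /=.
  by apply/orP; exact: Rtot.
Qed.

HB.instance Definition _ := isPointed.Build pOrd (exist (fun r => r \in pOrd_set) _ empty_pOrd).
HB.instance Definition _ :=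
  isPointed.Build Ord
    (exist (fun r => r \in Ord_set) _ (projT2 (cid Ord_nonempty))).

Definition rel_act (g : G) (r : relspace) : relspace :=
  fun p => r ((g^-1 * p.1)%g, (g^-1 * p.2)%g).

Lemma rel_act_pOrd g (o : pOrd) : rel_act g (set_val o) \in pOrd_set.
Proof.
have [irr asym tr] := set_mem (valP o); apply/mem_set.
split=> [x|x y|y x z]; rewrite /rel_of /rel_act /=.
- exact: irr.
- exact: asym.
- exact: tr.
Qed.

Lemma rel_act_Ord g (o : Ord) : rel_act g (set_val o) \in Ord_set.
Proof.
have [[irr asym tr] tot] := set_mem (valP o); apply/mem_set.
split; first split=> [x|x y|y x z]; rewrite /rel_of /rel_act /=.
- exact: irr.
- exact: asym.
- exact: tr.
- by move=> x y xy; apply: tot => /mulgI.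
Qed.

Definition pOrd_act (g : G) (o : pOrd) : pOrd :=
  exist (fun r => r \in pOrd_set) _ (rel_act_pOrd g o).
Definition Ord_act (g : G) (o : Ord) : Ord :=
  exist (fun r => r \in Ord_set) _ (rel_act_Ord g o).

End Orders.

(* The sigma-algebra is the Borel sigma-algebra of a complete separable metric,
   transported along a bijection f. *)
Definition standard_borel (R : realType) d (X : measurableType d) : Prop :=
  exists (P : metricType R) (f : X -> P),
    [/\ forall F : set_system P, ProperFilter F -> cauchy F ->
          exists l : P, F --> l,
        exists2 D : set P, countable D & dense D,
        bijective f &
        forall A : set X,
          measurable A <-> exists2 B : set P, <<s open >> B & A = f @^-1` B].

Section Actions.
Context (G : groupType) (R : realType).

Definition group_action (X : Type) (a : G -> X -> X) : Prop :=
  (forall x, a 1%g x = x) /\ (forall g h x, a (g * h)%g x = a g (a h x)).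

Definition stab (X : Type) (a : G -> X -> X) (x : X) : set G :=
  [set g | a g x = x].

Definition invariant_set (X : Type) (a : G -> X -> X) (A : set X) : Prop :=
  forall g, a g @^-1` A = A.

Definition invariant_measure d (X : measurableType d) (mu : probability X R)
    (a : G -> X -> X) : Prop :=
  forall g A, measurable A -> mu (a g @^-1` A) = mu A.

Definition pmp_action d (X : measurableType d) (mu : probability X R)
    (a : G -> X -> X) : Prop :=
  [/\ group_action a, forall g, measurable_fun [set: X] (a g) &
      invariant_measure mu a].

Definition ergodic d (X : measurableType d) (mu : probability X R)
    (a : G -> X -> X) : Prop :=
  forall A, measurable A -> invariant_set a A -> mu A = 0%E \/ mu A = 1%E.

Definition finitely_supported d (X : measurableType d) (mu : probability X R)
    : Prop :=
  exists2 F : set X, finite_set F & mu.-negligible (~` F).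

(* Only the values of f on X0 matter. *)
Definition isomorphic_actions d (X : measurableType d) (mu : probability X R)
    (a : G -> X -> X) d' (Y : measurableType d') (nu : probability Y R)
    (b : G -> Y -> Y) : Prop :=
  exists (X0 : set X) (Y0 : set Y) (f : X -> Y),
    [/\ [/\ measurable X0, invariant_set a X0 & mu X0 = 1%E],
        [/\ measurable Y0, invariant_set b Y0 & nu Y0 = 1%E],
        set_bij X0 Y0 f,
        (measurable_fun X0 f /\
         forall A, measurable A -> A `<=` X0 -> measurable (f @` A)) &
        (forall B, measurable B -> nu B = mu (X0 `&` f @^-1` B)) /\
        (forall g x, X0 x -> f (a g x) = b g (f x))].

End Actions.

(* Main.v *)
Require Import Defs.
From mathcomp Require Import all_boot all_order all_algebra.
From mathcomp Require Import all_classical all_reals all_analysis.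
From mathcomp Require Import measurable_realfun random_variable charge lra.

(** From left to right, let [f] be an isomorphism onto an invariant set of total
    orders.  Setting [pi x] to be [f x] where [f] is equivariant, and the empty
    order elsewhere, gives an equivariant map, and an element [g] of the
    stabilizer of [x] fixes the order [f x], which says that [f x] is invariant
    under left multiplication by [g].

    From right to left, code [X] by an injective measurable real function [phi]
    ([standard_borel_real_code]), so that every orbit is linearly ordered by
    [phi], and lift this to the group lexicographically: in the order [F x], [g]
    is below [h] when [phi (g^-1 x) < phi (h^-1 x)], or when
    [g^-1 x = h^-1 x] and [pi x] puts [g] below [h].  Two elements of the second
    kind differ by an element of the stabilizer of [g^-1 x], so equivariance of
    [pi] lets the total order on that stabilizer compare them.  Hence [F] is
    equivariant and [F x] is total for almost every [x].

    The point is that [F] is almost everywhere injective.  Let [u] be the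
    conditional expectation of [phi] with respect to [F].  Up to ties, the order
    [F x] knows whether [phi (g x) < phi x], and this forces conditioning to
    preserve such strict inequalities almost surely: [phi (g x) < phi x] implies
    [u (g x) < u x] ([cond_exp_decreasing]).  Ergodicity turns this comparison
    along orbits into a comparison on [X].  A sublevel set of [phi] and a
    sublevel set of [u] are nested up to a null set, since otherwise some orbit
    would meet both differences, where [phi] and [u] order its points in opposite
    ways.  And [u] is not constant on any set of positive measure: as [mu] has no
    atoms ([ergodic_diffuse]), such a set splits into a low part and a high part
    for [phi], and an orbit meeting both contradicts the strict decrease of [u].
    So the sublevel sets of [u] exhaust those of [phi]
    ([sublevel_from_factor]), [phi] is almost everywhere a function of [F]
    ([factor_determines]), and [x] can be decoded from [F x].  A measurable
    decoding map exhibits the image of [F] as a measurable set and yields the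
    isomorphism ([isomorphic_of_left_inverse]). *)

Set Implicit Arguments.
Unset Strict Implicit.
Unset Printing Implicit Defensive.

Import Order.TTheory GRing.Theory Num.Theory.
Import numFieldNormedType.Exports.

Local Open Scope classical_set_scope.
Local Open Scope ring_scope.

(** * Countable operations on measurable and negligible sets *)

Lemma countable_bigcapT_measurable d (T : measurableType d) (U : Type)
    (F : U -> set T) : countable [set: U] ->
  (forall i, measurable (F i)) -> measurable (\bigcap_i F i).
Proof.
move=> cU mF; rewrite -[X in measurable X]setCK; apply: measurableC.
rewrite setC_bigcap; apply: countable_bigcupT_measurable => // i.
exact: measurableC.
Qed.

Lemma measurable_forall d (T : measurableType d) (U : Type)
    (F : U -> set T) : countable [set: U] ->
  (forall i, measurable (F i)) -> measurable [set x | forall i, F i x].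
Proof.
move=> cU mF; have := countable_bigcapT_measurable cU mF; congr measurable.
by apply/seteqP; split=> x /= Fx i; [exact: Fx | move=> _; exact: Fx].
Qed.

Lemma measurable_exists d (T : measurableType d) (U : Type)
    (F : U -> set T) : countable [set: U] ->
  (forall i, measurable (F i)) -> measurable [set x | exists i, F i x].
Proof.
move=> cU mF; have := countable_bigcupT_measurable cU mF; congr measurable.
by apply/seteqP; split=> x /= [i] => [_|] Fx; exists i.
Qed.

Lemma measurable_const_set d (T : measurableType d) (Q : Prop) :
  measurable [set _ : T | Q].
Proof.
have [q|q] := pselect Q.
  by rewrite (_ : mkset _ = setT)//; apply/seteqP; split.
by rewrite (_ : mkset _ = set0)//; apply/seteqP; split.
Qed.

Lemma negligible_bigcup_countable (R : realType) d (X : measurableType d)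
    (mu : {measure set X -> \bar R}) (U : Type) (F : U -> set X) :
  countable [set: U] -> (forall i, mu.-negligible (F i)) ->
  mu.-negligible (\bigcup_i F i).
Proof.
move=> cU nF; have /countable_injP[f injf] := cU.
pose F' n := \bigcup_(i in [set i | f i = n]) F i.
apply: (@negligibleS _ _ _ mu (\bigcup_n F' n)).
  by move=> x [i _ Fx]; exists (f i) => //; exists i.
apply: negligible_bigcup => n.
have [[i fi]|nex] := pselect (exists i, f i = n); last first.
  rewrite (_ : F' n = set0); first exact: negligible_set0.
  by apply/seteqP; split=> // x [i fi]; case: nex; exists i.
apply: negligibleS (nF i) => x [j fj].
by rewrite (injf j i) ?inE// fj fi.
Qed.

Section conull.
Context (R : realType) d (X : measurableType d) (mu : probability X R).

Lemma negligible_conull (A : set X) : measurable A ->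
  mu.-negligible (~` A) <-> mu A = 1%E.
Proof.
move=> mA; have mC := measurableC mA; split=> [/negligibleP|A1].
  move=> /(_ mC) C0; have := probability_setC mu mC.
  by rewrite setCK C0 sube0.
have C0 : mu (~` A) = 0%E by rewrite probability_setC// A1 subee.
exact/negligibleP.
Qed.

Lemma measure_conullI (A B : set X) : measurable A -> measurable B ->
  mu A = 1%E -> mu (A `&` B) = mu B.
Proof.
move=> mA mB /negligible_conull-/(_ mA)/negligibleP-/(_ (measurableC mA)) C0.
apply/eqP; rewrite eq_le; apply/andP; split.
  by apply: le_measure; rewrite ?inE//; exact: measurableI.
rewrite -[leRHS]adde0 -C0.
apply: le_trans (measureU2 _ (measurableI _ _ mA mB) (measurableC mA)).
apply: le_measure; rewrite ?inE//.
  by apply: measurableU; [exact: measurableI|exact: measurableC].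
by move=> x Bx; have [Ax|nAx] := pselect (A x); [left|right].
Qed.

End conull.

(** * The spaces of orders *)

(** A neighbourhood in the product topology constrains only finitely many
    coordinates: the sets containing such a cylinder around [f] form a filter
    that converges to [f] coordinatewise. *)
Lemma nbhs_ptws_bool (I : choiceType) (f : {ptws I -> bool})
    (V : set {ptws I -> bool}) :
  nbhs f V -> exists s : seq I, forall g, {in s, g =1 f} -> V g.
Proof.
pose F : set_system {ptws I -> bool} :=
  [set V | exists s : seq I, forall g : {ptws I -> bool}, {in s, g =1 f} -> V g].
have FF : Filter F.
  split.
  - by exists [::].
  - move=> A B [s sA] [t tB]; exists (s ++ t) => g gf; split.
      by apply: sA => i si; apply: gf; rewrite mem_cat si.
    by apply: tB => i ti; apply: gf; rewrite mem_cat ti orbT.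
  - by move=> A B AB [s sA]; exists s => g /sA /AB.
suff : {ptws, F --> f} by apply.
apply/cvg_sup => i U /= [_ [[W oW <-] Wf WU]].
by exists [:: i] => g gf; apply: WU; rewrite /= gf ?mem_head.
Qed.

Section order_space.
Context (G : groupType).
Hypothesis cG : countable [set: G].

Lemma open_coord (A : set (relspace G)) p b :
  open [set o : set_type A | set_val o p = b].
Proof.
exists [set r : relspace G | r p = b] => //.
pose h (r : relspace G) := r p.
have ch : continuous h by exact: (@proj_continuous _ (fun=> bool) p).
by have /continuousP/(_ [set b]) := ch; apply; exact: discrete_open.
Qed.

(** Since [G] is countable there are countably many cylinders, so an open set
    of relations is a countable union of cylinders, whose preimages are finite
    intersections of preimages of coordinate sets. *)
Lemma preimage_open_measurable d (Z : measurableType d) (A : set (relspace G))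
    (h : Z -> set_type A) (U : set (set_type A)) :
  (forall p, measurable [set z | set_val (h z) p]) ->
  open U -> measurable (h @^-1` U).
Proof.
move=> mh [W oW <-].
pose cyl (s : seq (G * G * bool)) : set (relspace G) :=
  [set r | forall p, p \in s -> r p.1 = p.2].
pose C s : set Z := [set z | cyl s (set_val (h z)) /\ cyl s `<=` W].
have ce : countable [set: seq (G * G * bool)].
  have /countable_injP[f injf] := cG.
  pose g : seq (G * G * bool) -> seq (nat * nat * bool) :=
    map (fun p => (f p.1.1, f p.1.2, p.2)).
  apply/countable_injP; exists (pickle \o g); apply: in2W.
  apply: inj_comp; first exact: (pcan_inj pickleK).
  apply: inj_map => -[[a b] c] [[a' b'] c'] /= [] fa fb ->.
  by congr (_, _, _); apply: injf; rewrite ?inE.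
suff -> : h @^-1` (set_val @^-1` W) = \bigcup_s C s.
  apply: countable_bigcupT_measurable => // s; rewrite /C.
  have [sW|nsW] := pselect (cyl s `<=` W); last first.
    by rewrite (_ : mkset _ = set0)//; apply/seteqP; split=> z // [].
  rewrite (_ : mkset _ = [set z | cyl s (set_val (h z))]); last first.
    by apply/seteqP; split=> z // [].
  elim: s {sW} => [|[p b] s IH].
    by rewrite (_ : mkset _ = setT)//; apply/seteqP; split.
  rewrite (_ : mkset _ = [set z | set_val (h z) p = b] `&`
                         [set z | cyl s (set_val (h z))]); last first.
    apply/seteqP; split=> z /=.
      move=> c; split; first exact: (c (p, b) (mem_head _ _)).
      by move=> q qs; apply: c; rewrite inE qs orbT.
    by move=> [e c] q; rewrite inE => /predU1P[->//|]; exact: c.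
  apply: measurableI => //; case: b; first exact: mh.
  rewrite (_ : mkset _ = ~` [set z | set_val (h z) p]); last first.
    by apply/seteqP; split=> z /=; case: (set_val _ _).
  by apply: measurableC; exact: mh.
apply/seteqP; split=> z /=.
  move=> Wz; have : nbhs (set_val (h z)) W by exact: open_nbhs_nbhs.
  move=> /nbhs_ptws_bool[s sW].
  exists [seq (p, set_val (h z) p) | p <- s] => //; split.
    by move=> _ /mapP[p _ ->].
  move=> r cr; apply: sW => p ps.
  by rewrite (cr (p, set_val (h z) p))//; apply/mapP; exists p.
by move=> [s _ [cz]]; apply.
Qed.

Lemma measurable_to_pOrd d (Z : measurableType d) (h : Z -> pOrd G) :
  (forall p, measurable [set z | set_val (h z) p]) ->
  measurable_fun [set: Z] (h : Z -> borel (pOrd G)).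
Proof.
move=> mh; apply: (@measurability _ _ _ (borel (pOrd G)) _ _ open) => //.
by move=> _ [U oU <-]; rewrite setTI; exact: preimage_open_measurable.
Qed.

Lemma measurable_to_Ord d (Z : measurableType d) (h : Z -> Ord G) :
  (forall p, measurable [set z | set_val (h z) p]) ->
  measurable_fun [set: Z] (h : Z -> borel (Ord G)).
Proof.
move=> mh; apply: (@measurability _ _ _ (borel (Ord G)) _ _ open) => //.
by move=> _ [U oU <-]; rewrite setTI; exact: preimage_open_measurable.
Qed.

Lemma measurable_pOrd_coord p :
  measurable [set o : borel (pOrd G) | set_val (o : pOrd G) p].
Proof.
by apply: sub_sigma_algebra; exact: (@open_coord (@pOrd_set G) p true).
Qed.

Lemma measurable_Ord_coord p :
  measurable [set o : borel (Ord G) | set_val (o : Ord G) p].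
Proof.
by apply: sub_sigma_algebra; exact: (@open_coord (@Ord_set G) p true).
Qed.

Lemma Ord_sub_pOrd (o : Ord G) : set_val o \in @pOrd_set G.
Proof. by have [] := set_mem (valP o); rewrite inE. Qed.

Definition pOrd_of_Ord (o : Ord G) : pOrd G :=
  exist (fun r => r \in @pOrd_set G) _ (Ord_sub_pOrd o).

Lemma pOrd_inj (o o' : pOrd G) : set_val o =1 set_val o' -> o = o'.
Proof. by move=> oo'; apply: val_inj; apply/funext. Qed.

Lemma Ord_inj (o o' : Ord G) : set_val o =1 set_val o' -> o = o'.
Proof. by move=> oo'; apply: val_inj; apply/funext. Qed.

Lemma Ord_actE g (o : Ord G) p :
  set_val (Ord_act g o) p = set_val o ((g^-1 * p.1)%g, (g^-1 * p.2)%g).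
Proof. by []. Qed.

Lemma pOrd_actE g (o : pOrd G) p :
  set_val (pOrd_act g o) p = set_val o ((g^-1 * p.1)%g, (g^-1 * p.2)%g).
Proof. by []. Qed.

Lemma pOrd_of_OrdE (o : Ord G) : set_val (pOrd_of_Ord o) = set_val o.
Proof. by []. Qed.

Lemma Ord_actVK g (o : Ord G) : Ord_act g^-1%g (Ord_act g o) = o.
Proof.
by apply: Ord_inj => -[u v]; rewrite !Ord_actE /= invgK !mulKg.
Qed.

Lemma measurable_pOrd_of_Ord :
  measurable_fun setT (pOrd_of_Ord : borel (Ord G) -> borel (pOrd G)).
Proof. by apply: measurable_to_pOrd => // p; exact: measurable_Ord_coord. Qed.

Lemma measurable_pOrd_act g :
  measurable_fun setT (pOrd_act g : borel (pOrd G) -> borel (pOrd G)).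
Proof.
apply: measurable_to_pOrd => // p.
exact: (measurable_pOrd_coord ((g^-1 * p.1)%g, (g^-1 * p.2)%g)).
Qed.

Lemma measurable_total :
  measurable ([set o | Ord_set (set_val (o : pOrd G))] : set (borel (pOrd G))).
Proof.
rewrite (_ : mkset _ = [set o : pOrd G | forall p : G * G,
    p.1 <> p.2 -> set_val o p \/ set_val o (p.2, p.1)]); last first.
  apply/seteqP; split=> o /=.
    by move=> [_ tot] [u v] uv; exact: tot.
  move=> tot; split; first exact: set_mem (valP o).
  by move=> u v uv; exact: (tot (u, v)).
have cGG : countable [set: G * G] by rewrite -setXTT; exact: countableX.
pose C p : set (borel (pOrd G)) := [set o | set_val (o : pOrd G) p].
apply: (measurable_forall
  (F := fun p => [set o | p.1 <> p.2 -> C p o \/ C (p.2, p.1) o])) => // p.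
have [pE|pN] := pselect (p.1 = p.2).
  rewrite [X in measurable X](_ : _ = setT)//.
  by apply/seteqP; split=> // o _ /= /(_ pE).
rewrite [X in measurable X](_ : _ = C p `|` C (p.2, p.1)).
  by apply: measurableU; exact: measurable_pOrd_coord.
by apply/seteqP; split=> o /=; [exact|move=> + _].
Qed.

End order_space.

(** * Coding a standard Borel space by real numbers *)

Section ternary.
Context {R : realType}.

(** The first [n] terms of the series of the [c k / 3 ^ k]; the recursion is on
    the shifted sequence because digits are read off from the left. *)
Fixpoint ternary_trunc (c : nat -> bool) (n : nat) : R :=
  if n is n'.+1 then (c 0)%:R + ternary_trunc (c \o succn) n' / 3 else 0.

Definition ternary (c : nat -> bool) : R := limn (ternary_trunc c).

Lemma ternary_trunc_itv c n : 0 <= ternary_trunc c n <= 3 / 2.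
Proof.
elim: n c => [|n IH] c /=; first by lra.
have := IH (c \o succn); case: (c 0) => /=; lra.
Qed.

Lemma ternary_trunc_nd c n : ternary_trunc c n <= ternary_trunc c n.+1.
Proof.
elim: n c => [|n IH] c; first by have /andP[] := ternary_trunc_itv c 1.
have := IH (c \o succn).
rewrite -[ternary_trunc c n.+1]/((c 0)%:R + ternary_trunc (c \o succn) n / 3).
rewrite -[ternary_trunc c n.+2]/((c 0)%:R + ternary_trunc (c \o succn) n.+1 / 3).
lra.
Qed.

Lemma ternary_cvg c : ternary_trunc c @ \oo --> ternary c.
Proof.
apply: nondecreasing_is_cvgn; first exact/nondecreasing_seqP/ternary_trunc_nd.
by exists (3 / 2) => _ [n _ <-]; have /andP[] := ternary_trunc_itv c n.
Qed.

Lemma ternary_itv c : 0 <= ternary c <= 3 / 2.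
Proof.
apply/andP; split.
- apply: limr_ge; first exact: ternary_cvg.
  by near=> n; have /andP[] := ternary_trunc_itv c n.
- apply: limr_le; first exact: ternary_cvg.
  by near=> n; have /andP[] := ternary_trunc_itv c n.
Unshelve. all: by end_near. Qed.

Lemma ternaryS c : ternary c = (c 0)%:R + ternary (c \o succn) / 3.
Proof.
have : ternary_trunc c n.+1 @[n --> \oo] --> (c 0)%:R + ternary (c \o succn) / 3.
  apply: cvgD; first exact: cvg_cst.
  by apply: cvgMl; exact: ternary_cvg.
by rewrite (cvg_shiftS (ternary_trunc c)) => /(cvg_lim (@Rhausdorff R)).
Qed.

(** The left shift of the digits, as a function of a real number. *)
Definition ternary_shift (t : R) : R := 3 * (t - (1 <= t)%R%:R).

(** The tail contributes at most [3 / 2 / 3 = 1 / 2], so it cannot carry into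
    the leading digit; base 2 would be ambiguous here. *)
Lemma ternary_head c : (1 <= ternary c) = c 0.
Proof.
rewrite ternaryS; have := ternary_itv (c \o succn).
case: (c 0) => /= ?; first by lra.
by apply/negbTE; rewrite -ltNge; lra.
Qed.

Lemma ternary_iter c n : iter n ternary_shift (ternary c) = ternary (c \o addn n).
Proof.
elim: n c => [|n IH] c //=; rewrite IH /ternary_shift ternary_head.
rewrite ternaryS/= addn0.
rewrite (_ : (c \o addn n) \o succn = c \o addn n.+1); last first.
  by apply/funext => m /=; rewrite addnS.
by rewrite addrC addKr mulrCA divff ?mulr1.
Qed.

Lemma ternary_digit c n : (1 <= iter n ternary_shift (ternary c)) = c n.
Proof. by rewrite ternary_iter ternary_head /= addn0. Qed.

Lemma measurable_natr_bool d (X : measurableType d) (b : X -> bool) :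
  measurable [set x | b x] -> measurable_fun [set: X] (fun x => (b x)%:R : R).
Proof.
move=> mb; apply: (@eq_measurable_fun _ _ _ _ _ (\1_[set x | b x] : X -> R)).
  move=> x _; rewrite indicE; congr ((nat_of_bool _)%:R).
  by apply/idP/idP => [/set_mem|bx] //; apply/mem_set.
exact: measurable_indic.
Qed.

Lemma measurable_ternary d (X : measurableType d) (c : X -> nat -> bool) :
  (forall n, measurable [set x | c x n]) ->
  measurable_fun [set: X] (fun x => ternary (c x)).
Proof.
move=> mc.
apply: (@measurable_fun_cvg _ _ _ _ (fun n x => ternary_trunc (c x) n)).
  move=> n; elim: n c mc => [|n IH] c mc /=; first exact: measurable_cst.
  apply: measurable_funD.
    exact: measurable_natr_bool.
  apply: measurable_funM; last exact: measurable_cst.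
  by apply: (IH (fun x => c x \o succn)) => m; exact: mc.
by move=> x _; exact: ternary_cvg.
Qed.

Lemma measurable_ternary_shift : measurable_fun [set: R] ternary_shift.
Proof.
apply: measurable_funM; first exact: measurable_cst.
apply: measurable_funB; first exact: measurable_id.
have m1 : measurable [set t : R | 1 <= t].
  have : measurable `[1 : R, +oo[ by exact: measurable_itv.
  by congr measurable; apply/seteqP; split=> t /=; rewrite in_itv /= andbT.
exact: measurable_natr_bool.
Qed.

Lemma measurable_ternary_digit n :
  measurable [set t : R | 1 <= iter n ternary_shift t].
Proof.
have mi : measurable_fun [set: R] (iter n ternary_shift).
  elim: n => [|n IH]; first exact: measurable_id.
  exact: (measurableT_comp measurable_ternary_shift IH).
have := mi measurableT `[1, +oo[%classic (measurable_itv _).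
by rewrite setTI; congr measurable; apply/seteqP; split=> t /=;
  rewrite in_itv /= andbT.
Qed.

End ternary.

Section polish_space.
Context {R : realType}.

Lemma metric_ball_open (P : metricType R) (x : P) (e : R) : open (ball x e).
Proof.
rewrite openE => y; rewrite ballEmdist /= => xye; rewrite /interior.
rewrite -nbhs_ballE; exists (e - mdist x y); first by rewrite /= subr_gt0.
move=> z; rewrite !ballEmdist /= => yz.
by apply: le_lt_trans (metric_triangle x y z) _; lra.
Qed.

Lemma measurable_nat_rel d (T : measurableType d) (M N : T -> nat)
    (Q : nat -> nat -> Prop) :
  (forall n, measurable [set t | M t = n]) ->
  (forall n, measurable [set t | N t = n]) ->
  measurable [set t | Q (M t) (N t)].
Proof.
move=> mM mN.
have -> : [set t | Q (M t) (N t)] = [set t | exists m, exists n,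
    ([set t | M t = m] `&` [set t | N t = n] `&` [set _ | Q m n]) t].
  apply/seteqP; split=> t /=; first by move=> QMN; exists (M t), (N t).
  by move=> [m [n [[<- <-]]]].
apply: measurable_exists => // m; apply: measurable_exists => // n.
by apply: measurableI; [exact: measurableI|exact: measurable_const_set].
Qed.

(** The points [p (N k t)] converge at a rate that does not depend on [t].  On
    the measurable set [E] where this rate is respected the limit exists by
    completeness, and it lies in an open [U] exactly when some approximation is
    well inside [U]; this is a condition on the integers [N k t] only. *)
Lemma measurable_approx_limit (P : metricType R) (p : nat -> P)
    d (T : measurableType d) (N : nat -> T -> nat) :
  (forall F : set_system P, ProperFilter F -> cauchy F ->
     exists l : P, F --> l) ->
  (forall k n, measurable [set t | N k t = n]) ->
  exists psi : T -> P,
    (forall U, open U -> measurable (psi @^-1` U)) /\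
    (forall t y, (forall k, ball y k.+1%:R^-1 (p (N k t))) -> psi t = y).
Proof.
move=> cP mN.
pose r (k : nat) : R := k.+1%:R^-1.
have r0 k : 0 < r k by rewrite invr_gt0.
have rnd k l : (k <= l)%N -> r l <= r k.
  by move=> kl; rewrite lef_pV2 ?posrE// ler_nat.
have rlt e : 0 < e -> exists k, r k < e.
  by move=> e0; have [k ke] := ltr_add_invr e0; exists k; rewrite add0r in ke.
pose q k t := p (N k t).
(* Both q k t and q l t are within r k of a target point, hence the factor 2. *)
pose E : set T := [set t | forall k l, (k <= l)%N ->
  mdist (q k t) (q l t) < 2 * r k].
have mE : measurable E.
  apply: measurable_forall => // k; apply: measurable_forall => // l.
  exact: (@measurable_nat_rel _ _ (N k) (N l)
    (fun m n => (k <= l)%N -> mdist (p m) (p n) < 2 * r k)).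
have cvq t : E t -> exists y, forall k, mdist (q k t) y <= 2 * r k.
  move=> Et; have [] := cP (q ^~ t @ \oo).
    apply/cauchyP => e e0.
    have [k ke] := rlt (e / 2) (divr_gt0 e0 (ltr0Sn _ _)).
    exists (q k t); exists k => // l /= kl; rewrite ballEmdist /=.
    by apply: lt_trans (Et _ _ kl) _; lra.
  move=> y qy; exists y => k; apply/ler_addgt0Pr => e e0.
  have /qy : nbhs y (ball y e) by apply/nbhs_ballP; exists e.
  move=> [m _ ml]; have := ml (maxn m k) (leq_maxl _ _).
  rewrite /= ballEmdist /= => h.
  apply: le_trans (metric_triangle _ (q (maxn m k) t) _) _.
  by rewrite lerD//; [exact/ltW/Et/leq_maxr|rewrite metric_sym ltW].
pose psi t :=
  if pselect (E t) is left Et then projT1 (cid (cvq t Et)) else p 0%N.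
have psiE t k : E t -> mdist (q k t) (psi t) <= 2 * r k.
  by move=> Et; rewrite /psi; case: pselect => // Et'; case: cid.
have psiN t : ~ E t -> psi t = p 0%N by rewrite /psi; case: pselect.
exists psi; split.
  move=> U oU.
  (* The limit is within 2 r k of the k-th point, so the balls of radius 3 r k
     contain it. *)
  have -> : psi @^-1` U =
      (E `&` [set t | exists k, ball (p (N k t)) (3 * r k) `<=` U]) `|`
      (~` E `&` [set _ | U (p 0%N)]).
    apply/seteqP; split=> t /=.
      move=> Ut; have [Et|nEt] := pselect (E t); last first.
        by rewrite psiN // in Ut; right.
      left; split => //; have /nbhs_ballP[e e0 eU] : nbhs (psi t) U.
        exact: open_nbhs_nbhs.
      have [k ke] := rlt (e / 5) (divr_gt0 e0 (ltr0Sn _ _)).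
      exists k => z; rewrite ballEmdist /= => kz; apply: eU.
      rewrite ballEmdist /=.
      apply: le_lt_trans (metric_triangle _ (q k t) _) _.
      have := psiE t k Et; rewrite metric_sym => ?; rewrite -/(q k t) in kz; lra.
    case=> [[Et [k]]|[nEt Up]]; last by rewrite psiN.
    apply; rewrite ballEmdist /=; apply: le_lt_trans (psiE _ _ Et) _.
    by have := r0 k; lra.
  apply: measurableU; apply: measurableI => //.
  - apply: measurable_exists => // k.
    exact: (@measurable_nat_rel _ _ (N k) (N k)
      (fun m _ => ball (p m) (3 * r k) `<=` U)).
  - exact: measurableC.
  - exact: measurable_const_set.
move=> t y ty; have {}ty k : mdist y (q k t) < r k.
  by have := ty k; rewrite ballEmdist.
have Et : E t.
  move=> k l kl; apply: le_lt_trans (metric_triangle _ y _) _.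
  have := ty k; have := ty l; have := rnd _ _ kl.
  by rewrite (metric_sym y (q k t)); lra.
apply/esym/mdist_positivity/eqP; rewrite eq_le mdist_ge0 andbT.
apply/ler_addgt0Pr => e e0; rewrite add0r.
have [k ke] := rlt (e / 3) (divr_gt0 e0 (ltr0Sn _ _)).
apply: le_trans (metric_triangle _ (q k t) _) _.
by have := ty k; have := psiE t k Et; lra.
Qed.

Definition least (b : nat -> bool) : nat :=
  if pselect (exists n, b n) is left ex then ex_minn ex else 0%N.

Lemma leastP (b : nat -> bool) : (exists n, b n) -> b (least b).
Proof. by move=> ex; rewrite /least; case: pselect => // ex'; case: ex_minnP. Qed.

Lemma measurable_least d (T : measurableType d) (b : T -> nat -> bool) n :
  (forall m, measurable [set t | b t m]) ->
  measurable [set t | least (b t) = n].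
Proof.
move=> mb.
have mbN m : measurable [set t | ~~ b t m].
  rewrite (_ : mkset _ = ~` [set t | b t m]); first exact: measurableC.
  by apply/seteqP; split=> t /= /negP.
have -> : [set t | least (b t) = n] =
    ([set t | b t n] `&` [set t | forall m, (m < n)%N -> ~~ b t m]) `|`
    ([set t | forall m, ~~ b t m] `&` [set _ | n = 0%N]).
  apply/seteqP; split=> t /=; rewrite /least; case: pselect => [ex|nex].
  - case: ex_minnP => m bm mmin <-; left; split => // l lm.
    by apply/negP => /mmin; rewrite leqNgt lm.
  - by move=> <-; right; split => // m; apply/negP => bm; apply: nex; exists m.
  - case: ex_minnP => m bm mmin [[bn nmin]|[nb]]; last first.
      by rewrite (negbTE (nb m)) in bm.
    apply/eqP; rewrite eqn_leq mmin//= leqNgt; apply/negP => /nmin.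
    by rewrite bm.
  - by move=> [[bn _]|[_ ->]]//; case: nex; exists n.
apply: measurableU; apply: measurableI => //.
- apply: measurable_forall => // m; have [mn|mn] := boolP (m < n)%N.
    rewrite [X in measurable X](_ : _ = [set t | ~~ b t m])//.
    by apply/seteqP; split=> t /=; [exact|move=> + _].
  by rewrite [X in measurable X](_ : _ = setT)//; apply/seteqP; split.
- exact: measurable_forall.
- exact: measurable_const_set.
Qed.

(** The digits of [phi x] record which balls [ball (p n) (1 / k)] around the
    points of a dense sequence contain [x].  Picking for each [k] the first such
    ball reconstructs [x] as a limit, and this reconstruction makes sense
    measurably for every real number. *)
Lemma standard_borel_real_code d (X : measurableType d) : standard_borel R X ->
  exists (phi : X -> R) (psi : R -> X),
    [/\ measurable_fun setT phi, measurable_fun setT psi,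
        forall x, 0 <= phi x <= 3 / 2 & cancel phi psi].
Proof.
move=> [P [f [cP [D cD dD] [g fK gK] mX]]].
have /countable_injP[h injh] := cD.
pose p n := xget (f point) [set y | D y /\ h y = n].
have dp y e : 0 < e -> exists n, ball (p n) e y.
  move=> e0; have [||z [yz Dz]] := dD (ball y e).
  - by exists y; exact: ballxx.
  - exact: metric_ball_open.
  exists (h z); apply: ball_sym; suff -> : p (h z) = z by [].
  rewrite /p; case: xgetP => [w _ [Dw hw]|/(_ z)[]//].
  by apply: injh; rewrite ?inE.
pose c x i := if unpickle i is Some (n, k) then
  `[< ball (p n) (k.+1%:R^-1 : R) (f x) >] else false.
have mc i : measurable [set x | c x i].
  rewrite /c; case: (unpickle i) => [[n k]|]; last first.
    by rewrite (_ : mkset _ = set0)//; apply/seteqP; split.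
  apply/mX; exists (ball (p n) (k.+1%:R^-1 : R)).
    by apply: sub_sigma_algebra; exact: metric_ball_open.
  by apply/seteqP; split=> x /= /asboolP.
pose N (k : nat) (t : R) :=
  least (fun n => 1 <= iter (pickle (n, k)) ternary_shift t).
have mN k n : measurable [set t | N k t = n].
  apply: (@measurable_least _ _
    (fun t n => 1 <= iter (pickle (n, k)) ternary_shift t)) => m.
  exact: measurable_ternary_digit.
have [psi [mpsi psiE]] := measurable_approx_limit p cP mN.
exists (ternary \o c), (g \o psi); split.
- exact: measurable_ternary.
- move=> _ A /mX[B sB ->]; rewrite setTI.
  rewrite (_ : _ @^-1` _ = psi @^-1` B); last first.
    by apply/seteqP; split=> t /=; rewrite gK.
  pose S : set_system P := [set B | measurable (psi @^-1` B)].
  apply: (sB S); split => //=; split.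
  + by rewrite /S /= preimage_set0.
  + by move=> C mC; rewrite /S /= setTD preimage_setC; exact: measurableC.
  + move=> F mF; rewrite /S /= preimage_bigcup.
    exact: bigcupT_measurable.
- by move=> x; exact: ternary_itv.
- move=> x /=; apply: (canLR fK); apply: psiE => k; apply: ball_sym.
  have cE n : 1 <= iter (pickle (n, k)) (@ternary_shift R) (ternary (c x)) ->
      ball (p n) (k.+1%:R^-1 : R) (f x).
    by rewrite ternary_digit /c pickleK => /asboolP.
  apply: cE; rewrite /N; apply: (@leastP
    (fun n => 1 <= iter (pickle (n, k)) ternary_shift (ternary (c x) : R))).
  have [n xn] := dp (f x) (k.+1%:R^-1) ltac:(by rewrite invr_gt0).
  by exists n; rewrite ternary_digit /c pickleK; apply/asboolP.
Qed.

End polish_space.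

(** * Level sets of real functions *)

Lemma measurable_lt_set (R : realType) d (X : measurableType d) (h : X -> R)
    (r : R) :
  measurable_fun setT h -> measurable [set x | h x < r].
Proof.
move=> mh; have := mh measurableT `]-oo, r[%classic (measurable_itv _).
by rewrite setTI; congr measurable; apply/seteqP; split=> x /=; rewrite in_itv.
Qed.

Lemma measurable_ge_set (R : realType) d (X : measurableType d) (h : X -> R)
    (r : R) :
  measurable_fun setT h -> measurable [set x | r <= h x].
Proof.
move=> mh; rewrite (_ : mkset _ = ~` [set x | h x < r]).
  exact/measurableC/measurable_lt_set.
by apply/seteqP; split=> x /=; rewrite leNgt => /negP.
Qed.

Lemma measurable_eq_set (R : realType) d (X : measurableType d) (h : X -> R)
    (r : R) :
  measurable_fun setT h -> measurable [set x | h x = r].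
Proof.
by move=> mh; have := mh measurableT [set r] (measurable_set1 _); rewrite setTI.
Qed.

(** The levels whose strict sublevel set is null in [D] form a lower cut of the
    rationals; off a null set no rational separates two values of [h]. *)
Lemma ae_constant (R : realType) d (X : measurableType d)
    (mu : {measure set X -> \bar R}) (h : X -> R) (D : set X) :
  (forall s : rat, mu.-negligible (D `&` [set x | h x < ratr s]) \/
                   mu.-negligible (D `&` [set x | ratr s <= h x])) ->
  exists c, mu.-negligible (D `&` [set x | h x <> c]).
Proof.
move=> cut.
pose L (s : rat) := mu.-negligible (D `&` [set x | h x < ratr s]).
pose Z (s : rat) := if pselect (L s) then D `&` [set x | h x < ratr s]
                    else D `&` [set x | ratr s <= h x].
have nZ : mu.-negligible (\bigcup_s Z s).
  apply: negligible_bigcup_countable => // s; rewrite /Z.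
  by case: pselect => // nL; case: (cut s).
have [[x0 [Dx0 Zx0]]|nex] := pselect (exists x, D x /\ ~ (\bigcup_s Z s) x);
    last first.
  exists 0; apply: negligibleS nZ => x [Dx _].
  by apply: contrapT => nZx; apply: nex; exists x.
have le_off x y : D x -> D y -> ~ (\bigcup_s Z s) x -> ~ (\bigcup_s Z s) y ->
    h y <= h x.
  move=> Dx Dy nx ny; rewrite leNgt; apply/negP => /rat_in_itvoo[s].
  rewrite inE /= => /itvP sE.
  have [xs sy] : h x < ratr s /\ ratr s < h y by rewrite !sE.
  case: (pselect (L s)) => Ls.
    by apply: nx; exists s => //; rewrite /Z; case: pselect.
  apply: ny; exists s => //; rewrite /Z; case: pselect => [/Ls//|?] /=.
  by split=> //=; exact: ltW.
exists (h x0); apply: negligibleS nZ => x [Dx hx].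
apply: contrapT => nZx; apply: hx; apply/eqP.
by rewrite eq_le !le_off.
Qed.

(** * Conditional expectation along a map *)

(** The function [v \o F] is the conditional expectation of [f] with respect to
    the sigma-algebra generated by [F]: [v] is the density of the image under
    [F] of the charge [f mu] with respect to the image of [mu]. *)
Lemma cond_exp_along (R : realType) d (X : measurableType d) d'
    (Y : measurableType d') (mu : probability X R) (F : X -> Y) (f : X -> R) :
  measurable_fun setT F -> mu.-integrable setT (EFin \o f) ->
  exists v : Y -> R, [/\ measurable_fun setT v,
    mu.-integrable setT (EFin \o v \o F) &
    forall B, measurable B -> (\int[mu]_(x in F @^-1` B) (f x)%:E =
                         \int[mu]_(x in F @^-1` B) (v (F x))%:E)%E].
Proof.
move=> mF intf.
pose F' : {RV mu >-> Y} := mfun_Sub (mem_set mF).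
pose nu := distribution mu F'.
pose la' : {charge set Y -> \bar R} := pushforward (induced_charge intf) F.
pose la := la' mF.
have lanu : la `<< nu.
  apply/null_content_dominatesP => B mB nuB.
  have mFB : measurable (F @^-1` B) by have := mF measurableT _ mB; rewrite setTI.
  rewrite /la /la' /= /pushforward /induced_charge.
  apply: null_set_integral => //.
  by have /integrableP[+ _] := intf; exact: measurable_funTS.
pose v := fine \o (Radon_Nikodym la nu).
have vE y : (v y)%:E = (Radon_Nikodym la nu) y.
  by rewrite /v /= fineK// Radon_Nikodym_fin_num.
have mv : measurable_fun setT (EFin \o v).
  by rewrite (_ : EFin \o v = Radon_Nikodym la nu)//; apply/funext.
have iv : nu.-integrable setT (EFin \o v).
  rewrite (_ : EFin \o v = Radon_Nikodym la nu); last exact/funext.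
  exact: Radon_Nikodym_integrable.
have ivF : mu.-integrable setT (EFin \o v \o F).
  apply/integrableP; split; first exact: measurableT_comp.
  have /integrableP[_] := iv; apply: le_lt_trans.
  by rewrite ge0_integral_pushforward//; exact: measurableT_comp.
exists v; split => //; first exact/measurable_EFinP.
move=> B mB.
have mFB : measurable (F @^-1` B) by have := mF measurableT _ mB; rewrite setTI.
transitivity (la B) => //.
rewrite (Radon_Nikodym_integral lanu)//.
under eq_integral do rewrite -vE.
rewrite integral_pushforward//.
exact: integrableS ivF.
Qed.

(** * Ergodic actions *)

Section ergodic_action.
Context (R : realType) (G : groupType) d (X : measurableType d)
  (mu : probability X R) (a : G -> X -> X).
Hypotheses (cG : countable [set: G]) (pa : pmp_action mu a) (ea : ergodic mu a).

Let aM g h x : a (g * h)%g x = a g (a h x). Proof. by have [[]] := pa. Qed.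
Let a1 x : a 1%g x = x. Proof. by have [[]] := pa. Qed.
Let aVK g x : a (g^-1)%g (a g x) = x. Proof. by rewrite -aM mulVg. Qed.
Let aKV g x : a g (a (g^-1)%g x) = x. Proof. by rewrite -aM mulgV. Qed.

Lemma measurable_translate g (B : set X) :
  measurable B -> measurable (a g @^-1` B).
Proof.
by move=> mB; have [_ /(_ g measurableT _ mB) + _] := pa; rewrite setTI.
Qed.

(** Almost every orbit meets a set [B] of positive measure, because the union of
    its translates is invariant; in particular some orbit starting in [A] does. *)
Lemma ergodic_hits (A B N : set X) : measurable A -> measurable B ->
  mu.-negligible N -> mu A <> 0%E -> mu B <> 0%E ->
  exists x g, [/\ A x, ~ N x & B (a g x)].
Proof.
move=> mA mB N0 A0 B0.
pose C := \bigcup_g a g @^-1` B.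
have mC : measurable C.
  by apply: countable_bigcupT_measurable => // g; exact: measurable_translate.
have iC : invariant_set a C.
  move=> h; apply/seteqP; split=> x [g _] /= Bx.
    by exists (g * h)%g => //=; rewrite aM.
  by exists (g * h^-1)%g => //=; rewrite aM aVK.
have C1 : mu (~` C) = 0%E.
  rewrite probability_setC//; have [C0|->] := ea mC iC; last by rewrite subee.
  exfalso; apply: B0; apply/eqP; rewrite -measure_le0 -C0.
  by apply: le_measure; rewrite ?inE// => x Bx; exists 1%g => //=; rewrite a1.
apply: contrapT => nex; apply: A0; apply/negligibleP => //.
apply: (@negligibleS _ _ _ mu (N `|` ~` C)).
  move=> x Ax; apply: contrapT => /not_orP[nN /contrapT[g _ Bg]].
  by apply: nex; exists x, g.
by apply: negligibleU => //; apply/negligibleP => //; exact: measurableC.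
Qed.

Lemma integral_translate g (f : X -> R) (B : set X) : measurable B ->
  mu.-integrable setT (EFin \o f) ->
  (\int[mu]_(x in a g @^-1` B) (f (a g x))%:E = \int[mu]_(x in B) (f x)%:E)%E
  /\ mu.-integrable setT (EFin \o f \o a g).
Proof.
move=> mB intf; have [_ ma im] := pa.
have mf : measurable_fun setT (EFin \o f) by have /integrableP[] := intf.
have agE (D : set X) (h : X -> \bar R) : measurable D ->
    (\int[pushforward mu (a g)]_(x in D) h x = \int[mu]_(x in D) h x)%E.
  by move=> mD; apply: eq_measure_integral => A mA _; exact: im.
have intfg : mu.-integrable setT (EFin \o f \o a g).
  apply/integrableP; split; first exact: measurableT_comp.
  have /integrableP[_] := intf; apply: le_lt_trans.
  rewrite -[X in (_ <= X)%E](agE setT)//.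
  by rewrite ge0_integral_pushforward//; exact: measurableT_comp.
split=> //; rewrite -[RHS]agE// integral_pushforward//.
by apply: integrableS intfg => //; exact: measurable_translate.
Qed.

(** The points of the orbit of an atom all have the mass of the atom, so the orbit
    is finite, and it is conull by ergodicity. *)
Lemma ergodic_diffuse (x0 : X) : measurable [set x0] ->
  ~ finitely_supported mu -> mu [set x0] = 0%E.
Proof.
move=> m0 nfin; apply: contrapT => p0; apply: nfin.
have p_gt0 : (0 < mu [set x0])%E by rewrite lt0e measure_ge0 andbT; exact/eqP.
have agE g : [set a g x0] = a g^-1%g @^-1` [set x0].
  apply/seteqP; split=> x /=; first by move=> ->; exact: aVK.
  by move=> <-; rewrite aKV.
have [_ _ im] := pa.
pose Ob := \bigcup_g [set a g x0].
have mg g : measurable [set a g x0] by rewrite agE; exact: measurable_translate.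
have mOb : measurable Ob by exact: countable_bigcupT_measurable.
have iOb : invariant_set a Ob.
  move=> h; apply/seteqP; split=> x [g _] /= xE.
    by exists (h^-1 * g)%g => //=; rewrite aM -xE aVK.
  by exists (h * g)%g => //=; rewrite aM xE.
have muC0 : mu (~` Ob) = 0%E.
  rewrite probability_setC//; have [mu0|->] := ea mOb iOb; last by rewrite subee.
  exfalso; apply: p0; apply/eqP; rewrite -measure_le0 -mu0.
  by apply: le_measure; rewrite ?inE// => x ->; exists 1%g => //=; rewrite a1.
exists Ob; last by apply/negligibleP => //; exact: measurableC.
apply: contrapT => /infiniteP/pcard_leP[f].
have fO n : Ob (f n) by exact: funS.
have muf n : mu [set f n] = mu [set x0].
  by have [g _ ->] := fO n; rewrite agE im.
have mf n : measurable [set f n] by have [g _ ->] := fO n.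
have np n : (\sum_(i < n) mu [set x0] <= 1)%E.
  have tf : trivIset setT (fun i : 'I_n => [set f i]).
    by move=> i j _ _ [x [/= -> /inj ij]]; apply/val_inj/ij; rewrite inE.
  have mU : measurable (\big[setU/set0]_(i < n) [set f i]).
    by apply: bigsetU_measurable => i _; exact: mf.
  rewrite (eq_bigr (fun i : 'I_n => mu [set f i])) => [|i _]; last by rewrite muf.
  rewrite -(measure_semi_additive_ord mu (fun i : 'I_n => mf i) tf mU).
  exact: probability_le1.
have pfin : mu [set x0] \is a fin_num by exact: fin_num_measure.
have r0 : 0 < fine (mu [set x0]) by rewrite fine_gt0// p_gt0 ltey_eq pfin.
have := np (Num.trunc (fine (mu [set x0]))^-1).+1.
rewrite -(fineK pfin) sumEFin sumr_const card_ord lee_fin leNgt => /negP; apply.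
rewrite -mulr_natl -ltr_pdivrMr// div1r.
exact: truncnS_gt.
Qed.

(** * Functions determined by a factor *)

Section factor.
Context d' (Y : measurableType d') (F : X -> Y) (b : G -> Y -> Y).
Hypotheses (mF : measurable_fun setT F) (mb : forall g, measurable_fun setT (b g))
  (eF : forall g x, F (a g x) = b g (F x)).
(* The event S g, which is seen by the factor, decides whether g lowers phi, up
   to ties. *)
Variables (phi : X -> R) (S : G -> set Y).
Hypotheses (mphi : measurable_fun setT phi)
  (iphi : mu.-integrable setT (EFin \o phi))
  (mS : forall g, measurable (S g))
  (phiS : forall g x, phi (a g x) < phi x -> S g (F x))
  (Sphi : forall g x, S g (F x) -> phi (a g x) <= phi x).

(** Where [F x] tells that [phi (g x) <= phi x], let [V] be the part on which
    [v \o F] does not decrease under [g].  As [V] is a preimage under [F], the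
    integrals of [phi] and of its translate over [V] are those of [v \o F] and of
    its translate, so the integral of [phi] is the smaller one.  Being pointwise
    at least its translate on [V], [phi] is almost everywhere equal to it. *)
Lemma cond_exp_decreasing (v : Y -> R) g :
  measurable_fun setT v -> mu.-integrable setT (EFin \o v \o F) ->
  (forall B, measurable B -> (\int[mu]_(x in F @^-1` B) (phi x)%:E =
                         \int[mu]_(x in F @^-1` B) (v (F x))%:E)%E) ->
  mu.-negligible [set x | phi (a g x) < phi x /\ v (F x) <= v (F (a g x))].
Proof.
move=> mv iv vE.
pose B := S g `&` [set y | v y <= v (b g y)].
have mB : measurable B.
  apply: measurableI => //.
  have := measurable_fun_ler mv (measurableT_comp mv (mb g)).
  by move=> /(_ measurableT [set true] Logic.I); rewrite setTI.
have mB' : measurable (b g^-1%g @^-1` B).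
  by have := mb (g^-1%g) measurableT mB; rewrite setTI.
pose V := F @^-1` B; pose W := F @^-1` (b g^-1%g @^-1` B).
have mV : measurable V by have := mF measurableT mB; rewrite setTI.
have mW : measurable W by have := mF measurableT mB'; rewrite setTI.
have VW : a g @^-1` W = V.
  by apply/seteqP; split=> x; rewrite /W /V /preimage /= -eF aVK.
have [phiW iphig] := integral_translate g mW iphi.
have [vW ivg] := integral_translate g (f := v \o F) mW iv.
rewrite VW in phiW vW.
have le1 : (\int[mu]_(x in V) (phi x)%:E <=
            \int[mu]_(x in V) (phi (a g x))%:E)%E.
  rewrite phiW (vE _ mB) (vE _ mB') -vW; apply: le_integral => //.
  - exact: integrableS iv.
  - exact: integrableS ivg.
  - by move=> x /set_mem[_]; rewrite lee_fin /= eF.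
have iV : mu.-integrable V (EFin \o phi) by exact: integrableS iphi.
have iVg : mu.-integrable V (EFin \o (phi \o a g)) by exact: integrableS iphig.
have := integralB_EFin mV iV iVg => /= eqB.
have : ae_eq mu V (fun x => (phi x)%:E - (phi (a g x))%:E)%E (cst 0%E).
  apply/ae_eq_integral_abs => //.
    apply: emeasurable_funB.
      by have /integrableP[] := iV.
    by have /integrableP[] := iVg.
  apply/eqP; rewrite eq_le; apply/andP; split; last exact: integral_ge0.
  rewrite (eq_integral (fun x => (phi x)%:E - (phi (a g x))%:E)%E); last first.
    move=> x /set_mem[Sx _]; rewrite gee0_abs// -EFinB lee_fin subr_ge0.
    exact: Sphi.
  by rewrite eqB sube_le0.
move=> [N [mN N0 VN]]; exists N; split => // x [lt_phi le_v]; apply: VN => /=.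
apply/not_implyP; split.
  by split; [exact: phiS|rewrite /= -eF].
rewrite -EFinB => -[] /eqP; rewrite subr_eq0 => /eqP e.
by rewrite e ltxx in lt_phi.
Qed.

Hypothesis phi_diffuse : forall c, mu.-negligible [set x | phi x = c].

(** The set [e] is the union of the sublevel sets of [v], at rational levels,
    that are contained in [phi < q] up to a null set.  What [phi < q] has beyond
    [e] lies, up to a null set, between the two sides of a cut of the rationals,
    so [v \o F] is constant there; strict decrease along orbits then makes
    [phi] constant as well, and diffuseness makes this remainder null. *)
Lemma sublevel_from_factor (v : Y -> R) (q : R) : measurable_fun setT v ->
  (forall g, mu.-negligible
     [set x | phi (a g x) < phi x /\ v (F x) <= v (F (a g x))]) ->
  exists2 e : set Y, measurable e &
    mu.-negligible [set x | ~ (e (F x) <-> phi x < q)].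
Proof.
move=> mv dec.
pose N0 := \bigcup_g [set x | phi (a g x) < phi x /\ v (F x) <= v (F (a g x))].
have nN0 : mu.-negligible N0 by exact: negligible_bigcup_countable.
have decN0 x g : ~ N0 x -> phi (a g x) < phi x -> v (F (a g x)) < v (F x).
  by move=> nx lt; rewrite ltNge; apply/negP => le; apply: nx; exists g.
have mu0 (A : set X) : measurable A -> mu A <> 0%E \/ mu.-negligible A.
  move=> mA; have [A0|?] := pselect (mu A = 0%E); last by left.
  by right; apply/negligibleP.
have mvF : measurable_fun setT (v \o F) by exact: measurableT_comp.
(* Q r and P r are the two differences of the sublevel sets v < r and phi < q. *)
pose Q (r : R) := [set x | v (F x) < r] `&` [set x | q <= phi x].
pose P (r : R) := [set x | r <= v (F x)] `&` [set x | phi x < q].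
have mQ r : measurable (Q r).
  apply: measurableI; first exact: (measurable_lt_set _ mvF).
  exact: measurable_ge_set.
have mP r : measurable (P r).
  apply: measurableI; first exact: (measurable_ge_set _ mvF).
  exact: measurable_lt_set.
have chain r : mu.-negligible (Q r) \/ mu.-negligible (P r).
  have [Qr|] := mu0 _ (mQ r); last by left.
  have [Pr|] := mu0 _ (mP r); last by right.
  have [x [g [[vx qx] nx [vgx qgx]]]] := ergodic_hits (mQ r) (mP r) nN0 Qr Pr.
  have := decN0 x g nx (lt_le_trans qgx qx).
  by move=> /(lt_trans)/(_ vx); rewrite ltNge vgx.
pose I := [set r : rat | mu.-negligible (Q (ratr r))].
pose e : set Y := [set y | exists r : rat, I r /\ v y < ratr r].
have me : measurable e.
  apply: measurable_exists => // r.
  by apply: measurableI; [exact: measurable_const_set|exact: measurable_lt_set].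
exists e => //.
have meF : measurable (F @^-1` e) by have := mF measurableT me; rewrite setTI.
pose D := [set x | phi x < q] `&` ~` (F @^-1` e).
have mD : measurable D.
  by apply: measurableI; [exact: measurable_lt_set|exact: measurableC].
suff nD : mu.-negligible D.
  apply: (@negligibleS _ _ _ mu
    (D `|` \bigcup_r (if pselect (I r) then Q (ratr r) else set0))).
    move=> x /=; have [ex|nex] := pselect (e (F x)) => nx.
      right; have [r [Ir vr]] := ex; exists r => //.
      case: pselect => [?|/(_ Ir)//] /=; split => //=.
      rewrite leNgt; apply/negP => xq.
      by apply: nx; split.
    by left; split => //=; apply: contrapT => xq; apply: nx; split.
  apply: negligibleU => //; apply: negligible_bigcup_countable => // r.
  by case: pselect => [//|?] /=; exact: negligible_set0.
have [c Dc] : exists c, mu.-negligible (D `&` [set x | v (F x) <> c]).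
  apply: (@ae_constant _ _ _ mu (v \o F)) => s.
  have [Is|nIs] := pselect (I s); [left|right].
    rewrite (_ : _ `&` _ = set0); first exact: negligible_set0.
    by apply/seteqP; split=> x //= [[_ nx] vx]; apply: nx; exists s.
  have [//|Ps] := chain (ratr s).
  by apply: negligibleS Ps => x [[xq _] vx].
pose D1 := D `&` [set x | v (F x) = c].
have mD1 : measurable D1.
  by apply: measurableI => //; exact: (measurable_eq_set _ mvF).
suff nD1 : mu.-negligible D1.
  apply: negligibleS (negligibleU nD1 Dc) => x Dx.
  by have [vc|vc] := pselect (v (F x) = c); [left|right].
have [k D1k] : exists k, mu.-negligible (D1 `&` [set x | phi x <> k]).
  apply: ae_constant => s.
  have mA : measurable (D1 `&` [set x | phi x < ratr s]).
    by apply: measurableI => //; exact: measurable_lt_set.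
  have mB : measurable (D1 `&` [set x | ratr s <= phi x]).
    by apply: measurableI => //; exact: measurable_ge_set.
  have [A0|] := mu0 _ mA; last by left.
  have [B0|] := mu0 _ mB; last by right.
  have [x [g [[[_ vx] sx] nx [[_ vgx] sgx]]]] := ergodic_hits mB mA nN0 B0 A0.
  by have := decN0 x g nx (lt_le_trans sgx sx); rewrite vx vgx ltxx.
apply: negligibleS (negligibleU (phi_diffuse k) D1k) => x Dx.
by have [pk|pk] := pselect (phi x = k); [left|right].
Qed.

(** The value [phi x] is the infimum of the rationals [q] with [phi x < q], and
    these conditions are read off [F x]. *)
Lemma factor_determines (M : R) : (forall x, 0 <= phi x <= M) ->
  exists2 w : Y -> R, measurable_fun setT w &
    mu.-negligible [set x | w (F x) <> phi x].
Proof.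
move=> bphi.
have [v [mv iv vE]] := cond_exp_along mF iphi.
have dec g := cond_exp_decreasing g mv iv vE.
have ex q := sublevel_from_factor q mv dec.
pose e q := s2val (cid2 (ex q)).
have me q : measurable (e q) by exact: (s2valP (cid2 (ex q))).
have ne q : mu.-negligible [set x | ~ (e q (F x) <-> phi x < q)].
  exact: (s2valP' (cid2 (ex q))).
pose r n : R := ratr (odflt 0 (unpickle n) : rat).
(* Truncating at 0 and M keeps the sequence bounded below without changing the
   infimum, as phi takes its values between them. *)
pose h n y := if pselect (e (r n) y) then Num.max 0 (r n) else M.
pose w y := infs (h ^~ y) 0.
have M0 : 0 <= M by have /andP[] := bphi point; exact: le_trans.
have h0 y n : 0 <= h n y.
  by rewrite /h; case: pselect => [?|?] //=; rewrite le_max lexx.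
exists w.
  apply: measurable_fun_infs => [y _|n].
    by exists 0 => _ [n _ <-].
  rewrite (_ : h n = fun y => if y \in e (r n) then Num.max 0 (r n) else M);
      last first.
    apply/funext => y; rewrite /h; case: pselect => /= ey.
      by rewrite mem_set.
    by rewrite memNset.
  apply: measurable_fun_ifT; [|exact: measurable_cst|exact: measurable_cst].
  apply: (measurable_fun_bool true); rewrite setTI.
  have := me (r n); congr measurable.
  by apply/seteqP; split=> y /=; [exact: mem_set|exact: set_mem].
apply: (@negligibleS _ _ _ mu
  (\bigcup_n [set x | ~ (e (r n) (F x) <-> phi x < r n)])).
  move=> x wx; apply: contrapT => nx; apply: wx.
  have ee n : e (r n) (F x) <-> phi x < r n.
    by apply: contrapT => ne'; apply: nx; exists n.
  have phih n : phi x <= h n (F x).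
    rewrite /h; case: pselect => [/ee xr|?] /=; last by have /andP[] := bphi x.
    by rewrite le_max (ltW xr) orbT.
  apply/eqP; rewrite eq_le; apply/andP; split.
    apply/ler_addgt0Pr => t t0.
    have /rat_in_itvoo[s] : phi x < phi x + t by rewrite ltrDl.
    rewrite inE /= => /itvP sE.
    apply: (@le_trans _ _ (h (pickle s) (F x))).
      apply: ge_inf; first by exists 0 => _ [n _ <-].
      by exists (pickle s).
    have rs : r (pickle s) = ratr s by rewrite /r pickleK.
    rewrite /h; case: pselect => [?|ne'] /=; last first.
      by exfalso; apply: ne'; apply/ee; rewrite rs sE.
    by rewrite rs ge_max sE andbT; have /andP[] := bphi x; lra.
  apply: lb_le_inf; first by exists (h 0%N (F x)); exists 0%N.
  by move=> _ [n _ <-].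
exact: negligible_bigcup.
Qed.

End factor.

End ergodic_action.

(** * The lexicographic order of a point *)

Section lexicographic_order.
Context (G : groupType) (R : realType) (X : Type) (a : G -> X -> X).
Variables (phi : X -> R) (pi : X -> pOrd G).

Definition lex_rel (x : X) : relspace G := fun p =>
  let s := phi (a p.1^-1%g x) in let t := phi (a p.2^-1%g x) in
  (s < t)%R || ((s == t) && set_val (pi x) p).

Lemma lex_rel_strict x : lex_rel x \in @pOrd_set G.
Proof.
have [irr asym tr] := set_mem (valP (pi x)).
apply/mem_set; split; rewrite /rel_of /lex_rel /=.
- by move=> u; rewrite ltxx eqxx; exact: irr.
- move=> u v /orP[uv|/andP[/eqP -> uv]].
    by rewrite negb_or -leNgt (ltW uv) /= gt_eqF.
  by rewrite ltxx eqxx /=; exact: asym.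
- move=> v u w /orP[uv|/andP[/eqP -> uv]] /orP[vw|/andP[/eqP <- vw]].
  + by rewrite (lt_trans uv vw).
  + by rewrite uv.
  + by rewrite vw.
  + by rewrite ltxx eqxx /=; exact: tr vw.
Qed.

Definition lex_order (x : X) : pOrd G :=
  exist (fun r => r \in @pOrd_set G) _ (lex_rel_strict x).

Lemma lex_orderE x p : set_val (lex_order x) p = lex_rel x p.
Proof. by []. Qed.

Hypothesis ga : group_action a.

Lemma lex_order_equivariant :
  (forall g x, pi (a g x) = pOrd_act g (pi x)) ->
  forall g x, lex_order (a g x) = pOrd_act g (lex_order x).
Proof.
move=> epi g x; have [_ aM] := ga; apply: pOrd_inj => -[u v].
by rewrite pOrd_actE !lex_orderE /lex_rel /= epi pOrd_actE /= !invgM !invgK !aM.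
Qed.

(** A tie means that [g^-1 x = h^-1 x]; then [g^-1 h] fixes this point, and by
    equivariance comparing [g] with [h] for [pi x] is comparing [1] with
    [g^-1 h] for the order attached to this point. *)
Lemma lex_order_total x : injective phi ->
  (forall g x, pi (a g x) = pOrd_act g (pi x)) ->
  (forall g, strict_total_order (rel_restrict (S := stab a (a g x))
                                   (pOrd_rel (pi (a g x))))) ->
  Ord_set (set_val (lex_order x)).
Proof.
move=> iphi epi tot; have [a1 aM] := ga.
split; first exact: set_mem (valP (lex_order x)).
move=> g h gh; rewrite /rel_of !lex_orderE /lex_rel /=.
have [lt|lt|/iphi e] := ltgtP (phi (a g^-1%g x)) (phi (a h^-1%g x)).
- by left.
- by right.
rewrite /=.
pose S := stab a (a g^-1%g x).
have s1 : (1%g : G) \in S by apply/mem_set; exact: a1.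
have sgh : (g^-1 * h)%g \in S.
  by apply/mem_set; rewrite /S /stab /= {1}e -aM -mulgA mulgV mulg1.
pose u : set_type S := exist (fun k => k \in S) _ s1.
pose v : set_type S := exist (fun k => k \in S) _ sgh.
have uv : u <> v.
  by case=> gh1; apply: gh; rewrite -[h](mulVKg g) -gh1 mulg1.
have := (tot g^-1%g).2 u v uv.
rewrite /rel_restrict /pOrd_rel /rel_of epi !pOrd_actE.
rewrite -[set_val u]/(1%g : G) -[set_val v]/(g^-1 * h)%g /=.
by rewrite invgK mulg1 mulVKg.
Qed.

End lexicographic_order.

Lemma measurable_lex_order (G : groupType) (R : realType) d (X : measurableType d)
    (a : G -> X -> X) (phi : X -> R) (pi : X -> pOrd G) :
  countable [set: G] ->
  (forall g, measurable_fun setT (a g)) -> measurable_fun setT phi ->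
  measurable_fun setT (pi : X -> borel (pOrd G)) ->
  measurable_fun setT (lex_order a phi pi : X -> borel (pOrd G)).
Proof.
move=> cG ma mphi mpi; apply: measurable_to_pOrd => // p.
have mpa g : measurable_fun setT (phi \o a g) by exact: measurableT_comp.
have mlt := measurable_fun_ltr (mpa p.1^-1%g) (mpa p.2^-1%g).
have meq := measurable_fun_eqr (mpa p.1^-1%g) (mpa p.2^-1%g).
have := mlt measurableT [set true] Logic.I.
have := meq measurableT [set true] Logic.I.
have := mpi measurableT _ (measurable_pOrd_coord p).
rewrite !setTI => m1 m2 m3.
have := measurableU _ _ m3 (measurableI _ _ m2 m1); congr measurable.
apply/seteqP; split=> x; rewrite /= lex_orderE /lex_rel /=.
  by move=> [->//|[-> ->]]; rewrite orbT.
by move=> /orP[|/andP[]]; [left|right].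
Qed.

(** * Isomorphisms from measurable left inverses *)

Section left_inverse.
Context (G : groupType) (R : realType) d (X : measurableType d)
  (mu : probability X R) (a : G -> X -> X).
Hypotheses (cG : countable [set: G]) (pa : pmp_action mu a).

Lemma negligible_translate g (N : set X) :
  mu.-negligible N -> mu.-negligible (a g @^-1` N).
Proof.
move=> [M [mM M0 NM]]; have [_ _ im] := pa; exists (a g @^-1` M); split.
- exact: (measurable_translate pa g mM).
- by rewrite im.
- by move=> x /NM.
Qed.

Section image_in_Ord.
Variables (F : X -> pOrd G) (W : pOrd G -> X).
Hypotheses (mF : measurable_fun setT (F : X -> borel (pOrd G)))
  (mW : measurable_fun setT (W : borel (pOrd G) -> X))
  (eF : forall g x, F (a g x) = pOrd_act g (F x))
  (mfix : measurable [set x | W (F x) = x])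
  (Ftot : mu.-negligible [set x | ~ Ord_set (set_val (F x))])
  (FW : mu.-negligible [set x | W (F x) <> x]).

(** The map [F] with values in total orders; [point] is an arbitrary total
    order. *)
Let f (x : X) : Ord G :=
  if pselect (Ord_set (set_val (F x))) is left p then
    exist (fun r => r \in @Ord_set G) _ (mem_set p) else point.

Let fE x : Ord_set (set_val (F x)) -> set_val (f x) = set_val (F x).
Proof. by rewrite /f; case: pselect. Qed.

Let mT : measurable [set x | Ord_set (set_val (F x))].
Proof. by have := mF measurableT (measurable_total cG); rewrite setTI. Qed.

Let mf : measurable_fun setT (f : X -> borel (Ord G)).
Proof.
apply: measurable_to_Ord => // p.
rewrite (_ : mkset _ =
  ([set x | Ord_set (set_val (F x))] `&` [set x | set_val (F x) p]) `|`
  (~` [set x | Ord_set (set_val (F x))] `&` [set _ | set_val (point : Ord G) p])).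
  apply: measurableU; apply: measurableI => //.
  - by have := mF measurableT (measurable_pOrd_coord p); rewrite setTI.
  - exact: measurableC.
  - exact: measurable_const_set.
apply/seteqP; split=> x /=.
  rewrite /f; case: pselect => Tx /= fx; first by left.
  by right.
by move=> [[Tx Fx]|[Tx Px]]; rewrite /f; case: pselect.
Qed.

Let W' (o : Ord G) : X := W (pOrd_of_Ord o).

Let mW' : measurable_fun setT (W' : borel (Ord G) -> X).
Proof. exact: (measurableT_comp mW (measurable_pOrd_of_Ord cG)). Qed.

(** The largest invariant set on which [F] takes total orders and [W] inverts
    it. *)
Let X0 := [set x |
  forall g, Ord_set (set_val (F (a g x))) /\ W (F (a g x)) = a g x].

Let X0E x : X0 x -> Ord_set (set_val (F x)) /\ W (F x) = x.
Proof. by have [[a1 _] _ _] := pa; move=> /(_ 1%g); rewrite a1. Qed.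

Let X0a g x : X0 x -> X0 (a g x).
Proof. by have [[_ aM] _ _] := pa; move=> Xx h; rewrite -aM; exact: Xx. Qed.

Let W'f x : X0 x -> W' (f x) = x.
Proof.
move=> /X0E[Tx Wx]; rewrite /W' -[RHS]Wx; congr W.
by apply: pOrd_inj => p; rewrite pOrd_of_OrdE fE.
Qed.

Let f_equiv g x : X0 x -> f (a g x) = Ord_act g (f x).
Proof.
move=> Xx; have [Tx _] := X0E Xx; have [Tgx _] := X0E (X0a g Xx).
by apply: Ord_inj => p; rewrite Ord_actE !fE// eF pOrd_actE.
Qed.

Let mX0 : measurable X0.
Proof.
apply: measurable_forall => // g.
have := measurable_translate pa g (measurableI _ _ mT mfix).
by congr measurable.
Qed.

Let X01 : mu X0 = 1%E.
Proof.
apply/negligible_conull => //.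
have := negligible_bigcup_countable cG
  (fun g => negligible_translate g (negligibleU Ftot FW)).
apply: negligibleS => x /existsNP[g /not_andP ng].
by exists g.
Qed.

(** The image of [X0]; the left inverse [W'] turns membership in the image into
    a measurable condition. *)
Let Y0 := [set o : Ord G | X0 (W' o) /\ f (W' o) = o].

Let Y0f x : X0 x -> Y0 (f x).
Proof. by move=> Xx; rewrite /Y0 /= W'f. Qed.

Let image_f A : A `<=` X0 -> f @` A = Y0 `&` W' @^-1` A.
Proof.
move=> AX; apply/seteqP; split=> o /=.
  by move=> [x Ax <-]; rewrite W'f; [split=> //; exact/Y0f/AX|exact: AX].
by move=> [[_ fo] Ao]; exists (W' o).
Qed.

Let measurable_Ord_eq (h k : borel (Ord G) -> borel (Ord G)) :
  measurable_fun setT h -> measurable_fun setT k ->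
  measurable [set o | h o = k o].
Proof.
move=> mh mk.
pose c (l : borel (Ord G) -> borel (Ord G)) p :=
  [set o | set_val (l o : Ord G) p].
have mc l p : measurable_fun setT l -> measurable (c l p).
  by move=> ml; have := ml measurableT _ (measurable_Ord_coord p); rewrite setTI.
have cGG : countable [set: G * G] by rewrite -setXTT; exact: countableX.
rewrite (_ : mkset _ = [set o | forall p, ((c h p `&` c k p) `|`
    (~` c h p `&` ~` c k p)) o]).
  apply: measurable_forall => // p.
  by apply: measurableU; apply: measurableI; do ?apply: measurableC; exact: mc.
apply/seteqP; split=> o /=.
  move=> hk p; rewrite /c /setU /setI /setC /= hk.
  by have [|/negP] := boolP (set_val _ _); [left|right].
move=> hk; apply: Ord_inj => p; have := hk p; rewrite /c /=.
by move=> [[-> ->]//|[/negP/negbTE -> /negP/negbTE ->]].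
Qed.

Let mY0 : measurable (Y0 : set (borel (Ord G))).
Proof.
apply: measurableI; first by have := mW' measurableT mX0; rewrite setTI.
apply: (@measurable_Ord_eq (f \o W') id) => //.
exact: measurableT_comp.
Qed.

(** The isomorphism is [F] itself, viewed in the space of total orders where its
    values are total; the image of a measurable set is measurable, as it is cut
    out by the preimage under the left inverse. *)
Lemma isomorphic_of_left_inverse :
  exists nu : probability (borel (Ord G)) R,
     invariant_measure nu (@Ord_act G) /\
     isomorphic_actions mu a nu (@Ord_act G).
Proof.
have [[a1 aM] ma im] := pa.
pose f' : {RV mu >-> borel (Ord G)} := mfun_Sub (mem_set mf).
pose nu : probability (borel (Ord G)) R := distribution mu f'.
have nuE B : nu B = mu (f @^-1` B) by [].
have mfB (B : set (borel (Ord G))) : measurable B -> measurable (f @^-1` B).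
  by move=> mB; have := mf measurableT mB; rewrite setTI.
have mact g (B : set (borel (Ord G))) : measurable B ->
    measurable (Ord_act g @^-1` B : set (borel (Ord G))).
  move=> mB.
  have mg : measurable_fun setT (Ord_act g : borel (Ord G) -> borel (Ord G)).
    apply: measurable_to_Ord => // p.
    exact: (measurable_Ord_coord ((g^-1 * p.1)%g, (g^-1 * p.2)%g)).
  by have := mg measurableT _ mB; rewrite setTI.
exists nu; split.
  move=> g B mB; rewrite !nuE.
  rewrite -(measure_conullI mX0 (mfB _ (mact g _ mB)) X01).
  rewrite -(im g _ (mfB _ mB)).
  rewrite -(measure_conullI mX0 (measurable_translate pa g (mfB _ mB)) X01).
  by congr (mu _); apply/seteqP; split=> x [Xx] /=; rewrite f_equiv.
exists X0, Y0, f; split.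
- split => // g; apply/seteqP; split=> x /= Xx; last exact: X0a.
  by rewrite -[x]a1 -(mulVg g) aM; exact: X0a.
- split => //.
    move=> g; apply/seteqP; split=> o.
      rewrite /preimage /= => -[Xo fo].
      rewrite -(Ord_actVK g o) -fo -f_equiv//.
      exact/Y0f/X0a.
    move=> [Xo fo]; rewrite /preimage /= -fo -f_equiv//.
    exact/Y0f/X0a.
  rewrite nuE; apply/eqP; rewrite eq_le -{2}X01; apply/andP; split.
    exact/probability_le1/mfB.
  by apply: le_measure; rewrite ?inE//; exact: mfB.
- split.
  + by move=> x /Y0f.
  + by move=> x y /set_mem Xx /set_mem Xy fxy; rewrite -(W'f Xx) fxy W'f.
  + by move=> o [Xo fo]; exists (W' o).
- split; first exact: measurable_funTS.
  move=> A mA AX; rewrite image_f//; apply: measurableI => //.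
  by have := mW' measurableT mA; rewrite setTI.
- split; last by move=> g x Xx; exact: f_equiv.
  by move=> B mB; rewrite nuE (measure_conullI mX0 (mfB _ mB)).
Qed.

End image_in_Ord.
End left_inverse.

(** * Both directions *)

(** An element [g] of the stabilizer of [x] fixes [f x] by equivariance, and the
    orders fixed by [g] are those invariant under left multiplication by [g]. *)
Lemma isomorphic_order_on_stab (G : groupType) (R : realType) d
    (X : measurableType d) (mu : probability X R) (a : G -> X -> X)
    (nu : probability (borel (Ord G)) R) :
  countable [set: G] -> isomorphic_actions mu a nu (@Ord_act G) ->
  exists pi : X -> pOrd G,
     [/\ measurable_fun [set: X] (pi : X -> borel (pOrd G)),
         (forall g x, pi (a g x) = pOrd_act g (pi x)) &
         {ae mu, forall x,
            strict_total_order (rel_restrict (S := stab a x) (pOrd_rel (pi x))) /\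
            left_invariant_on (stab a x) (pOrd_rel (pi x))}].
Proof.
move=> cG [X0 [Y0 [f [[mX0 iX0 X01] _ _ [mf _] [_ ef]]]]].
pose emp : pOrd G := exist (fun r => r \in @pOrd_set G) _ (empty_pOrd G).
pose pi x := if x \in X0 then pOrd_of_Ord (f x) else emp.
have iX0' g x : (a g x \in X0) = (x \in X0).
  have XE : X0 (a g x) = X0 x := congr1 (fun A : set X => A x) (iX0 g).
  by apply/idP/idP; rewrite !inE XE.
exists pi; split.
- apply: measurable_to_pOrd => // p.
  have := mf mX0 _ (measurable_Ord_coord p); congr measurable.
  apply/seteqP; split=> x /=; rewrite /pi.
    by move=> [Xx fx]; rewrite mem_set.
  by case: ifPn => // /set_mem.
- move=> g x; rewrite /pi iX0'; case: ifPn => [/set_mem Xx|_].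
    by rewrite ef//; exact: pOrd_inj.
  exact: pOrd_inj.
- have : mu.-negligible (~` X0) by exact/negligible_conull.
  apply: negligibleS => x; apply: contra_not => Xx /=.
  rewrite /pi mem_set//.
  have [[irr asym tr] tot] := set_mem (valP (f x)).
  split; first split; first split.
  + by move=> u; exact: irr.
  + by move=> u v; exact: asym.
  + by move=> v u w; exact: tr.
  + by move=> u v uv; apply: tot => /val_inj.
  move=> g u v gx _ _.
  have fE : Ord_act g (f x) = f x by rewrite -ef// gx.
  rewrite /pOrd_rel /rel_of pOrd_of_OrdE.
  have /(congr1 (fun o => set_val o ((g * u)%g, (g * v)%g))) := fE.
  by rewrite Ord_actE /= !mulKg => ->.
Qed.

(** The lexicographic order decides whether [g] lowers [phi], up to ties, so
    [phi x] and hence [x] can be recovered from it almost everywhere. *)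
Lemma order_on_stab_isomorphic (G : groupType) (R : realType) d
    (X : measurableType d) (mu : probability X R) (a : G -> X -> X)
    (pi : X -> pOrd G) :
  countable [set: G] -> standard_borel R X -> pmp_action mu a ->
  ergodic mu a -> ~ finitely_supported mu ->
  measurable_fun [set: X] (pi : X -> borel (pOrd G)) ->
  (forall g x, pi (a g x) = pOrd_act g (pi x)) ->
  {ae mu, forall x, strict_total_order
     (rel_restrict (S := stab a x) (pOrd_rel (pi x)))} ->
  exists nu : probability (borel (Ord G)) R,
     invariant_measure nu (@Ord_act G) /\
     isomorphic_actions mu a nu (@Ord_act G).
Proof.
move=> cG sX pa ea nfin mpi epi [N [mN N0 totN]].
have [ga ma _] := pa; have [a1 aM] := ga.
have [phi [psi [mphi mpsi bphi phiK]]] := standard_borel_real_code sX.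
have phi_inj := can_inj phiK.
pose F := lex_order a phi pi.
have mF : measurable_fun setT (F : X -> borel (pOrd G)).
  exact: measurable_lex_order.
have eF g x : F (a g x) = pOrd_act g (F x) by exact: lex_order_equivariant.
have iphi : mu.-integrable setT (EFin \o phi).
  apply: measurable_bounded_integrable => //.
    by rewrite (le_lt_trans (probability_le1 _ _)) ?ltry.
  exists (3 / 2)%R; split; first exact: num_real.
  move=> M ltM x _ /=; have /andP[? ?] := bphi x.
  by rewrite ger0_norm//; apply: le_trans (ltW ltM).
have diffuse c : mu.-negligible [set x | phi x = c].
  have [[x0 xc]|nex] := pselect (exists x, phi x = c); last first.
    rewrite (_ : mkset _ = set0); first exact: negligible_set0.
    by apply/seteqP; split=> // x xc; case: nex; exists x.
  have E : [set x | phi x = c] = [set x0].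
    by apply/seteqP; split=> x /= => [xE|->//]; apply: phi_inj; rewrite xE.
  have m0 : measurable [set x0] by rewrite -E; exact: measurable_eq_set.
  by rewrite E; apply/negligibleP => //; exact: (ergodic_diffuse cG pa ea).
(* S g consists of the orders that put g^-1 below 1. *)
pose S g : set (borel (pOrd G)) := [set o | set_val (o : pOrd G) (g^-1%g, 1%g)].
have SE g x : S g (F x) = ((phi (a g x) < phi x)%R ||
    ((phi (a g x) == phi x) && set_val (pi x) (g^-1%g, 1%g))).
  by rewrite /S /F /= lex_orderE /lex_rel /= invgK invg1 a1.
have [w mw wphi] : exists2 w : borel (pOrd G) -> R, measurable_fun setT w &
    mu.-negligible [set x | w (F x) <> phi x].
  apply: (factor_determines cG pa ea mF (measurable_pOrd_act cG) eF mphi iphi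
            (S := S) _ _ _ diffuse bphi).
  - by move=> g; exact: measurable_pOrd_coord.
  - by move=> g x lt; rewrite SE lt.
  - by move=> g x; rewrite SE => /orP[/ltW//|/andP[/eqP -> _]].
have mW : measurable_fun setT (psi \o w) by exact: measurableT_comp.
apply: (isomorphic_of_left_inverse cG pa mF mW eF).
- rewrite (_ : mkset _ = [set x | phi (psi (w (F x))) = phi x]); last first.
    by apply/seteqP; split=> x /= => [->//|/phi_inj].
  have := measurable_fun_eqr
    (measurableT_comp mphi (measurableT_comp mW mF)) mphi.
  move=> /(_ measurableT [set true] Logic.I); rewrite setTI; congr measurable.
  by apply/seteqP; split=> x /= /eqP.
- apply: negligibleS (negligible_bigcup_countable cG (fun g =>
    negligible_translate pa g (ex_intro _ N (And3 mN N0 (@subset_refl _ N))))).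
  move=> x nx; apply: contrapT => good; apply: nx.
  apply: (lex_order_total ga phi_inj epi) => g.
  apply: contrapT => ntot; apply: good; exists g => //=.
  exact: totN.
- by apply: negligibleS wphi => x /= WF wE; apply: WF; rewrite wE phiK.
Qed.

Theorem theorem5p3 (G : groupType) (R : realType) (d : measure_display)
    (X : measurableType d) (mu : probability X R) (a : G -> X -> X) :
  countable [set: G] ->
  standard_borel R X ->
  pmp_action mu a ->
  ergodic mu a ->
  ~ finitely_supported mu ->
  (exists nu : probability (borel (Ord G)) R,
     invariant_measure nu (@Ord_act G) /\
     isomorphic_actions mu a nu (@Ord_act G)) <->
  (exists pi : X -> pOrd G,
     [/\ measurable_fun [set: X] (pi : X -> borel (pOrd G)),
         (forall g x, pi (a g x) = pOrd_act g (pi x)) &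
         {ae mu, forall x,
            strict_total_order (rel_restrict (S := stab a x) (pOrd_rel (pi x))) /\
            left_invariant_on (stab a x) (pOrd_rel (pi x))}]).
Proof.
move=> cG sX pa ea nfin; split=> [[nu [_ iso]]|[pi [mpi epi tot]]].
  exact: isomorphic_order_on_stab cG iso.
apply: (order_on_stab_isomorphic cG sX pa ea nfin mpi epi).
by apply: filterS tot => x [].
Qed.
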